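(* Consider the linear system and the interval-based inference attack described in the context. Fix $k\ge1$, the intervals $\mathcal{X}_{k-1|k-1}$, $\mathcal{Y}_{k-1|k-1}$, a number $\epsilon^x>0$, and an interval $\mathcal{S}^x_{k|k}=[\underline{S}^x_{k|k},\overline{S}^x_{k|k}]$ containing the true public state $x_k$ with $\mathcal{S}^x_{k|k}\subseteq\mathcal{X}_{k|k-1}$ and $\overline{\mathrm{Vol}}(\mathcal{S}^x_{k|k})\le\epsilon^x$. The privacy filter optimization problem $$\mathbf{P_1}:\quad \max_{\mathcal{M}^x_{k|k}}\ \overline{\mathrm{Vol}}(\mathcal{Y}_{k|k})\quad\text{s.t.}\quad \mathcal{S}^x_{k|k}\subseteq\mathcal{M}^x_{k|k}\subseteq\mathcal{X}_{k|k-1},\quad \overline{\mathrm{Vol}}(\mathcal{M}^x_{k|k})\le\epsilon^x,$$ over intervals $\mathcal{M}^x_{k|k}=[\underline{M}^x_{k|k},\overline{M}^x_{k|k}]$, where $\mathcal{Y}_{k|k}$ is obtained from $\mathcal{M}^x_{k|k}$ by the interval-based inference attack, is equivalent to the linear program $$\mathbf{P_2}:\quad \min_{\epsilon^y,\ \mathcal{M}^x_{k|k},\ p^{\Delta x}_{k-1|k},\ p^{\Delta y}_{k-1|k}}\ \epsilon^y$$ subject to $$\left\||A_3|p^{\Delta x}_{k-1|k}+|A_4|p^{\Delta y}_{k-1|k}\right\|_1\le\epsilon^y,\qquad \left\|\overline{M}^x_{k|k}-\underline{M}^x_{k|k}\right\|_1\le\epsilon^x,$$ $$\underline{X}_{k|k-1}\le\underline{M}^x_{k|k}\le\underline{S}^x_{k|k},\qquad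 \overline{S}^x_{k|k}\le\overline{M}^x_{k|k}\le\overline{X}_{k|k-1},$$ $$\mathcal{M}^x_{k-1|k}=\Psi(A_1^{-1})\mathcal{M}^x_{k|k}\oplus\Psi(-A_1^{-1}A_2)\mathcal{Y}_{k-1|k-1}\oplus\Psi(-A_1^{-1}B_1)\mathcal{W}^x_k,$$ $$\mathcal{M}^y_{k-1|k}=\Psi(A_2^{-1})\mathcal{M}^x_{k|k}\oplus\Psi(-A_2^{-1}A_1)\mathcal{X}_{k-1|k-1}\oplus\Psi(-A_2^{-1}B_1)\mathcal{W}^x_k,$$ and, for both $(z,Z)=(x,X)$ and $(z,Z)=(y,Y)$, $$p^{\Delta z}_{k-1|k}\ge0,\qquad p^{\Delta z}_{k-1|k}\ge p^z_{k-1|k-1}-p^{m,z}_{k-1|k},$$ $$2p^{\Delta z}_{k-1|k}\ge\overline{Z}_{k-1|k-1}-\overline{M}^z_{k-1|k},\qquad 2p^{\Delta z}_{k-1|k}\ge\underline{M}^z_{k-1|k}-\underline{Z}_{k-1|k-1},$$ where $p^{\Delta x}_{k-1|k},p^{\Delta y}_{k-1|k}\in\mathbb{R}^{n_x}$, $\epsilon^y\ge0$, the interval $\mathcal{M}^x_{k|k}$ is represented by its endpoint vector in $\mathbb{R}^{2n_x}$, all vector inequalities are componentwise, and $p^z_{k-1|k-1}$, $p^{m,z}_{k-1|k}$ are the radii of $\mathcal{Z}_{k-1|k-1}$ and $\mathcal{M}^z_{k-1|k}$. Equivalence means: an interval $\mathcal{M}^x_{k|k}$ is an optimal solution of $\mathbf{P_1}$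 if and only if there exist $\epsilon^y,p^{\Delta x}_{k-1|k},p^{\Delta y}_{k-1|k}$ such that $(\epsilon^y,\mathcal{M}^x_{k|k},p^{\Delta x}_{k-1|k},p^{\Delta y}_{k-1|k})$ is an optimal solution of $\mathbf{P_2}$.
   Context: System: $X_k=A_1X_{k-1}+A_2Y_{k-1}+B_1W^x_k$, $Y_k=A_3X_{k-1}+A_4Y_{k-1}+B_2W^y_k$, with public state $X_k\in\mathbb{R}^{n_x}$, private state $Y_k\in\mathbb{R}^{n_x}$, real matrices of compatible sizes, $A_1,A_2$ invertible. The disturbances satisfy $W^x_k\in\mathcal{W}^x_k$, $W^y_k\in\mathcal{W}^y_k$ with $\mathcal{W}^x_k,\mathcal{W}^y_k$ bounded intervals (boxes); $\mathcal{X}_{k-1|k-1}$ and $\mathcal{Y}_{k-1|k-1}$ are bounded intervals containing the true states $x_{k-1}$, $y_{k-1}$. Interval conventions: an interval $\mathcal{Z}=\{Z:\underline{Z}\le Z\le\overline{Z}\}\subset\mathbb{R}^n$ (componentwise) is identified with the stacked endpoint vector $[\underline{Z}^\top,\overline{Z}^\top]^\top\in\mathbb{R}^{2n}$; its radius is $(\overline{Z}-\underline{Z})/2$. A $2m\times2n$ matrix acts on an interval by multiplying the endpoint vector; $\oplus$ is the sum of endpoint vectors. Intersection: $\mathcal{X}\cap\mathcal{Y}=[\max\{\underline{X},\underline{Y}\}^\top,\min\{\overline{X},\overline{Y}\}^\top]^\top$ (componentwise). The surrogate volume is $\overline{\mathrm{Vol}}(\mathcal{Z})=\sum_{i=1}^n(\overline{Z}(i)-\underline{Z}(i))$.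 For a matrix $A=[a_{ij}]$, $|A|=[|a_{ij}|]$; for a vector $b$, $\|b\|_1=\sum_i|b(i)|$. Define $$\Psi(A)=\begin{bmatrix}\frac{A+|A|}{2}&\frac{A-|A|}{2}\\ \frac{A-|A|}{2}&\frac{A+|A|}{2}\end{bmatrix}.$$ Predicted public set: $\mathcal{X}_{k|k-1}=\Psi(A_1)\mathcal{X}_{k-1|k-1}\oplus\Psi(A_2)\mathcal{Y}_{k-1|k-1}\oplus\Psi(B_1)\mathcal{W}^x_k$, with endpoints $\underline{X}_{k|k-1},\overline{X}_{k|k-1}$. Interval-based inference attack at time $k$, given the observation interval $\mathcal{M}^x_{k|k}$: $\mathcal{M}^x_{k-1|k}=\Psi(A_1^{-1})\mathcal{M}^x_{k|k}\oplus\Psi(-A_1^{-1}A_2)\mathcal{Y}_{k-1|k-1}\oplus\Psi(-A_1^{-1}B_1)\mathcal{W}^x_k$; $\mathcal{M}^y_{k-1|k}=\Psi(A_2^{-1})\mathcal{M}^x_{k|k}\oplus\Psi(-A_2^{-1}A_1)\mathcal{X}_{k-1|k-1}\oplus\Psi(-A_2^{-1}B_1)\mathcal{W}^x_k$; $\mathcal{X}_{k-1|k}=\mathcal{M}^x_{k-1|k}\cap\mathcal{X}_{k-1|k-1}$; $\mathcal{Y}_{k-1|k}=\mathcal{M}^y_{k-1|k}\cap\mathcal{Y}_{k-1|k-1}$; $\mathcal{Y}_{k|k}=\Psi(A_3)\mathcal{X}_{k-1|k}\oplus\Psi(A_4)\mathcal{Y}_{k-1|k}\oplus\Psi(B_2)\mathcal{W}^y_k$.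 *)

(* Defs.v *)
From HB Require Import structures.
From mathcomp Require Import all_boot all_order all_algebra.
From mathcomp Require Import classical_sets reals.
Set Implicit Arguments.
Unset Strict Implicit.
Unset Printing Implicit Defensive.
Import Order.TTheory GRing.Theory Num.Theory.
Local Open Scope classical_set_scope.
Local Open Scope ring_scope.

Definition lev (R : realType) (n : nat) (u v : 'cV[R]_n) : Prop :=
  forall i, u i 0 <= v i 0.

Definition norm1 (R : realType) (n : nat) (b : 'cV[R]_n) : R :=
  \sum_i `|b i 0|.

Definition absmx (R : realType) (m n : nat) (A : 'M[R]_(m, n)) : 'M[R]_(m, n) :=
  map_mx (fun a : R => `|a|) A.

(* A box of R^n is handled through its stacked endpoint vector in R^(n + n),
   lower endpoints first. The operations below are total on endpoint vectors,
   including those whose lower part is not below their upper part. *)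
Notation endpoints R n := 'cV[R]_(n + n).

Definition lo (R : realType) (n : nat) (Z : endpoints R n) : 'cV[R]_n :=
  usubmx Z.

Definition hi (R : realType) (n : nat) (Z : endpoints R n) : 'cV[R]_n :=
  dsubmx Z.

Definition is_interval (R : realType) (n : nat) (Z : endpoints R n) : Prop :=
  lev (lo Z) (hi Z).

Definition box (R : realType) (n : nat) (Z : endpoints R n) : set 'cV[R]_n :=
  [set v | lev (lo Z) v /\ lev v (hi Z)].

Definition radius (R : realType) (n : nat) (Z : endpoints R n) : 'cV[R]_n :=
  2^-1 *: (hi Z - lo Z).

Definition capI (R : realType) (n : nat) (Z1 Z2 : endpoints R n) :
    endpoints R n :=
  col_mx (map2_mx Num.max (lo Z1) (lo Z2)) (map2_mx Num.min (hi Z1) (hi Z2)).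

Definition Vol (R : realType) (n : nat) (Z : endpoints R n) : R :=
  \sum_i (hi Z i 0 - lo Z i 0).

Definition Psi (R : realType) (m n : nat) (A : 'M[R]_(m, n)) :
    'M[R]_(m + m, n + n) :=
  block_mx (2^-1 *: (A + absmx A)) (2^-1 *: (A - absmx A))
           (2^-1 *: (A - absmx A)) (2^-1 *: (A + absmx A)).

(* n is the dimension of both the public and the private state; p and q are
   the dimensions of the disturbances on the public and the private state. *)
Record lin_system (R : realType) (n p q : nat) := LinSystem {
  A1 : 'M[R]_n; A2 : 'M[R]_n; A3 : 'M[R]_n; A4 : 'M[R]_n;
  B1 : 'M[R]_(n, p); B2 : 'M[R]_(n, q) }.

Definition trajectory (R : realType) (n p q : nat) (s : lin_system R n p q)
    (x y : nat -> 'cV[R]_n) (wx : nat -> 'cV[R]_p) (wy : nat -> 'cV[R]_q) :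
    Prop :=
  forall k, (0 < k)%N ->
    x k = A1 s *m x k.-1 + A2 s *m y k.-1 + B1 s *m wx k /\
    y k = A3 s *m x k.-1 + A4 s *m y k.-1 + B2 s *m wy k.

(* X_{k|k-1}. Here and below, X and Y stand for the prior sets X_{k-1|k-1}
   and Y_{k-1|k-1}, Wx and Wy for the disturbance sets at time k, and M for
   the observation interval M^x_{k|k}. *)
Definition predicted (R : realType) (n p q : nat) (s : lin_system R n p q)
    (X Y : endpoints R n) (Wx : endpoints R p) : endpoints R n :=
  Psi (A1 s) *m X + Psi (A2 s) *m Y + Psi (B1 s) *m Wx.

(* M^x_{k-1|k} *)
Definition back_x (R : realType) (n p q : nat) (s : lin_system R n p q)
    (Y : endpoints R n) (Wx : endpoints R p) (M : endpoints R n) :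
    endpoints R n :=
  Psi (invmx (A1 s)) *m M + Psi (- invmx (A1 s) *m A2 s) *m Y
  + Psi (- invmx (A1 s) *m B1 s) *m Wx.

(* M^y_{k-1|k} *)
Definition back_y (R : realType) (n p q : nat) (s : lin_system R n p q)
    (X : endpoints R n) (Wx : endpoints R p) (M : endpoints R n) :
    endpoints R n :=
  Psi (invmx (A2 s)) *m M + Psi (- invmx (A2 s) *m A1 s) *m X
  + Psi (- invmx (A2 s) *m B1 s) *m Wx.

(* Y_{k|k}, computed from X_{k-1|k} and Y_{k-1|k} *)
Definition attack (R : realType) (n p q : nat) (s : lin_system R n p q)
    (X Y : endpoints R n) (Wx : endpoints R p) (Wy : endpoints R q)
    (M : endpoints R n) : endpoints R n :=
  let X' := capI (back_x s Y Wx M) X in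
  let Y' := capI (back_y s X Wx M) Y in
  Psi (A3 s) *m X' + Psi (A4 s) *m Y' + Psi (B2 s) *m Wy.

Definition is_argmax (R : realType) (T : Type) (feas : T -> Prop) (f : T -> R)
    (t : T) : Prop :=
  feas t /\ forall t', feas t' -> f t' <= f t.

Definition is_argmin (R : realType) (T : Type) (feas : T -> Prop) (f : T -> R)
    (t : T) : Prop :=
  feas t /\ forall t', feas t' -> f t <= f t'.

Definition P1_feasible (R : realType) (n p q : nat) (s : lin_system R n p q)
    (X Y : endpoints R n) (Wx : endpoints R p) (S : endpoints R n) (epsx : R)
    (M : endpoints R n) : Prop :=
  [/\ is_interval M,
      box S `<=` box M,
      box M `<=` box (predicted s X Y Wx) &
      Vol M <= epsx].

Definition P1_optimal (R : realType) (n p q : nat) (s : lin_system R n p q)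
    (X Y : endpoints R n) (Wx : endpoints R p) (Wy : endpoints R q)
    (S : endpoints R n) (epsx : R) (M : endpoints R n) : Prop :=
  is_argmax (P1_feasible s X Y Wx S epsx)
            (fun M' => Vol (attack s X Y Wx Wy M')) M.

(* The constraints tying the slack vector pd = p^{Delta z}_{k-1|k} to the
   prior set Z = Z_{k-1|k-1} and to MZ = M^z_{k-1|k}. *)
Definition slack_constraints (R : realType) (n : nat) (Z MZ : endpoints R n)
    (pd : 'cV[R]_n) : Prop :=
  [/\ lev 0 pd,
      lev (radius Z - radius MZ) pd,
      lev (hi Z - hi MZ) (2 *: pd) &
      lev (lo MZ - lo Z) (2 *: pd)].

Record P2_var (R : realType) (n : nat) := P2Var {
  epsy : R; obs : endpoints R n; pdx : 'cV[R]_n; pdy : 'cV[R]_n }.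

Definition P2_feasible (R : realType) (n p q : nat) (s : lin_system R n p q)
    (X Y : endpoints R n) (Wx : endpoints R p) (S : endpoints R n) (epsx : R)
    (v : P2_var R n) : Prop :=
  let M := obs v in
  let P := predicted s X Y Wx in
  [/\ 0 <= epsy v,
      norm1 (absmx (A3 s) *m pdx v + absmx (A4 s) *m pdy v) <= epsy v,
      norm1 (hi M - lo M) <= epsx,
      (lev (lo P) (lo M) /\ lev (lo M) (lo S)) /\
      (lev (hi S) (hi M) /\ lev (hi M) (hi P)) &
      slack_constraints X (back_x s Y Wx M) (pdx v) /\
      slack_constraints Y (back_y s X Wx M) (pdy v)].

Definition P2_optimal (R : realType) (n p q : nat) (s : lin_system R n p q)
    (X Y : endpoints R n) (Wx : endpoints R p) (S : endpoints R n) (epsx : R)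
    (v : P2_var R n) : Prop :=
  is_argmin (P2_feasible s X Y Wx S epsx) (@epsy R n) v.

(* Main.v *)
(** [Psi A] multiplies radii by [|A|], so that [Vol (attack M)] is a constant
    minus twice [loss M], the entry sum of [|A3| dx + |A4| dy], where [dx] and
    [dy] are the decreases in radius caused by the two intersections of the
    attack. The slack constraints say exactly that the slack vectors dominate
    [dx] and [dy]; since [|A3|] and [|A4|] are nonnegative, the least value of
    [epsy] compatible with [M] is [loss M]. *)
Require Import Defs.
From mathcomp Require Import all_boot all_order all_algebra.
From mathcomp Require Import classical_sets reals.
From mathcomp Require Import ring lra.
Import Order.TTheory GRing.Theory Num.Theory.
Local Open Scope classical_set_scope.
Local Open Scope ring_scope.

Lemma lev_refl (R : realType) (n : nat) (u : 'cV[R]_n) : lev u u.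
Proof. by move=> i. Qed.

Lemma lev_trans (R : realType) (n : nat) (u v w : 'cV[R]_n) :
  lev u v -> lev v w -> lev u w.
Proof. by move=> uv vw i; apply: le_trans (uv i) (vw i). Qed.

Lemma box_nonempty_interval (R : realType) (n : nat) (Z : endpoints R n) v :
  box Z v -> is_interval Z.
Proof. by case; apply: lev_trans. Qed.

(** Inclusion need only be tested at the corners [lo Z1] and [hi Z1], which belong to [box Z1]
    because it is nonempty. *)
Lemma box_subsetP (R : realType) (n : nat) (Z1 Z2 : endpoints R n) :
  is_interval Z1 ->
  box Z1 `<=` box Z2 <-> lev (lo Z2) (lo Z1) /\ lev (hi Z1) (hi Z2).
Proof.
move=> Z1i; split=> [sub | [l h] v [lv vh]]; last first.
  by split; [apply: lev_trans l lv | apply: lev_trans vh h].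
have [l _] : box Z2 (lo Z1) by apply: sub; split=> //; apply: lev_refl.
by have [_ h] : box Z2 (hi Z1) by apply: sub; split=> //; apply: lev_refl.
Qed.

Lemma norm1_nonneg (R : realType) (n : nat) (b : 'cV[R]_n) :
  lev 0 b -> norm1 b = \sum_i b i 0.
Proof.
by move=> b0; apply: eq_bigr => i _; rewrite ger0_norm //; have := b0 i; rewrite mxE.
Qed.

Lemma norm1_width (R : realType) (n : nat) (Z : endpoints R n) :
  is_interval Z -> norm1 (hi Z - lo Z) = Vol Z.
Proof.
move=> Zi; rewrite norm1_nonneg => [|i]; last by have := Zi i; rewrite /lo /hi !mxE subr_ge0.
by apply: eq_bigr => i _; rewrite !mxE.
Qed.

Lemma absmx_mul_mono (R : realType) (m n : nat) (A : 'M[R]_(m, n)) u v :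
  lev u v -> lev (absmx A *m u) (absmx A *m v).
Proof.
by move=> uv i; rewrite !mxE; apply: ler_sum => j _; rewrite mxE ler_wpM2l.
Qed.

Lemma Vol_radius (R : realType) (n : nat) (Z : endpoints R n) :
  Vol Z = 2 * \sum_i radius Z i 0.
Proof.
rewrite mulr_sumr; apply: eq_bigr => i _.
by rewrite !mxE mulrA divff ?mul1r // pnatr_eq0.
Qed.

Lemma radiusD (R : realType) (n : nat) (Z1 Z2 : endpoints R n) :
  radius (Z1 + Z2) = radius Z1 + radius Z2.
Proof. by apply/matrixP => i j; rewrite !mxE; ring. Qed.

(** Subtracting the lower half of [Psi A] from the upper one cancels [A] and leaves [|A|] acting on
    the width. *)
Lemma radius_Psi (R : realType) (m n : nat) (A : 'M[R]_(m, n))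
    (Z : endpoints R n) :
  radius (Psi A *m Z) = absmx A *m radius Z.
Proof.
rewrite /radius -scalemxAr; congr (_ *: _).
rewrite -[Z in LHS]vsubmxK /Psi mul_block_col /lo /hi col_mxKu col_mxKd.
rewrite -!scalemxAl !mulmxDl !mulNmx mulmxBr.
move: (A *m _) (A *m _) (absmx A *m _) (absmx A *m _) => al ah bl bh.
by apply/matrixP => i j; rewrite !mxE; lra.
Qed.

(** In each coordinate the decrease in radius is the maximum of four affine expressions, one for
    each way of resolving the [min] and the [max]. This also covers an empty intersection, whose
    radius has a negative entry. *)
Lemma slack_constraintsP (R : realType) (n : nat) (Z MZ : endpoints R n) pd :
  slack_constraints Z MZ pd <-> lev (radius Z - radius (capI MZ Z)) pd.
Proof.
(* One coordinate: [Z = [a, b]], [MZ = [c, d]], and [e] is the entry of [pd]. *)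
have scalar (a b c d e : R) :
    2^-1 * (b - a) - 2^-1 * (Num.min d b - Num.max c a) <= e <->
    [/\ 0 <= e, 2^-1 * (b - a) - 2^-1 * (d - c) <= e,
        b - d <= 2 * e & c - a <= 2 * e].
  case: (lerP d b) => ?; case: (lerP c a) => ?;
    (split=> [?|[? ? ? ?]]; first (split; lra)); lra.
have E i : (radius Z - radius (capI MZ Z)) i 0 =
    2^-1 * (hi Z i 0 - lo Z i 0)
    - 2^-1 * (Num.min (hi MZ i 0) (hi Z i 0) - Num.max (lo MZ i 0) (lo Z i 0)).
  by rewrite /radius /capI /lo /hi col_mxKu col_mxKd !mxE.
split=> [[c1 c2 c3 c4] i | c].
  rewrite E; apply/scalar; move: (c1 i) (c2 i) (c3 i) (c4 i).
  by rewrite /radius /lo /hi !mxE.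
split=> i; move: (c i); rewrite E => /scalar[];
  by rewrite /radius /lo /hi !mxE.
Qed.

Section PrivacyFilter.

Context (R : realType) (n p q : nat) (s : lin_system R n p q).
Context (X Y : endpoints R n) (Wx : endpoints R p) (Wy : endpoints R q).
Context (S : endpoints R n) (epsx : R).

Let dx (M : endpoints R n) := radius X - radius (capI (back_x s Y Wx M) X).
Let dy (M : endpoints R n) := radius Y - radius (capI (back_y s X Wx M) Y).
Let cost (u v : 'cV[R]_n) := absmx (A3 s) *m u + absmx (A4 s) *m v.
Let loss (M : endpoints R n) := \sum_i cost (dx M) (dy M) i 0.

(** The decrease dominates itself, so it satisfies the slack constraints, the first of which is
    nonnegativity. *)
Let radius_loss_ge0 (Z MZ : endpoints R n) :
  lev 0 (radius Z - radius (capI MZ Z)).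
Proof. by have /slack_constraintsP[] := lev_refl _ _ (radius Z - radius (capI MZ Z)). Qed.

(** Unlike [mxE], this does not expand matrix products into sums. *)
Let addE (u v : 'cV[R]_n) i : (u + v) i 0 = u i 0 + v i 0.
Proof. by rewrite mxE. Qed.

Let oppE (u : 'cV[R]_n) i : (- u) i 0 = - u i 0.
Proof. by rewrite mxE. Qed.

Let cost_mono u u' v v' : lev u u' -> lev v v' -> lev (cost u v) (cost u' v').
Proof.
by move=> uu vv i; rewrite !addE lerD //; apply: absmx_mul_mono.
Qed.

Let cost_ge0 u v : lev 0 u -> lev 0 v -> lev 0 (cost u v).
Proof. by move=> /cost_mono uv /uv; rewrite /cost !mulmx0 addr0. Qed.

(** The first term, free of [M], is the volume obtained when neither intersection removes
    anything. *)
Lemma Vol_attack M :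
  Vol (attack s X Y Wx Wy M) =
  2 * \sum_i (cost (radius X) (radius Y) + absmx (B2 s) *m radius Wy) i 0
  - 2 * loss M.
Proof.
rewrite Vol_radius -mulrBr -sumrB; congr (_ * _); apply: eq_bigr => i _.
rewrite /attack !radiusD !radius_Psi /cost /dx /dy !mulmxBr.
by rewrite !(addE, oppE); ring.
Qed.

Lemma le_Vol_attack M M' :
  (Vol (attack s X Y Wx Wy M') <= Vol (attack s X Y Wx Wy M)) =
  (loss M <= loss M').
Proof.
rewrite !Vol_attack; move: (loss M) (loss M') (\sum_i _) => a b c.
by rewrite lerD2l lerN2 ler_pM2l ?ltr0n.
Qed.

Hypothesis S_interval : is_interval S.

Lemma P2_feasible_loss ey M u v :
  P2_feasible s X Y Wx S epsx (P2Var ey M u v) ->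
  P1_feasible s X Y Wx S epsx M /\ loss M <= ey.
Proof.
case=> /= _ cost_le vol [[PM MS] [SM MP]] [/slack_constraintsP du /slack_constraintsP dv].
(* The chain is [lo M <= lo S <= hi S <= hi M]. *)
have Mi : is_interval M := lev_trans _ _ _ _ _ MS (lev_trans _ _ _ _ _ S_interval SM).
split; first by split=> //; [exact/box_subsetP | exact/box_subsetP | rewrite -norm1_width].
apply: le_trans cost_le; rewrite norm1_nonneg; last first.
  by apply: cost_ge0; [apply: lev_trans du | apply: lev_trans dv].
by apply: ler_sum => i _; apply: cost_mono.
Qed.

(** Taking the decreases themselves as slack vectors attains the lower bound on [epsy]. *)
Lemma P2_feasible_at_loss M :
  P1_feasible s X Y Wx S epsx M ->
  P2_feasible s X Y Wx S epsx (P2Var (loss M) M (dx M) (dy M)).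
Proof.
case=> Mi /(box_subsetP _ _ _ _ S_interval)[MS SM].
case/(box_subsetP _ _ _ _ Mi)=> PM MP vol.
have cost0 : lev 0 (cost (dx M) (dy M)) by apply: cost_ge0; apply: radius_loss_ge0.
split=> //=.
- by apply: sumr_ge0 => i _; apply: le_trans (cost0 i); rewrite mxE.
- by rewrite norm1_nonneg.
- by rewrite norm1_width.
- by split; apply/slack_constraintsP; apply: lev_refl.
Qed.

(** Both problems minimise [loss] over the same observations: feasible points of the linear program
    project to feasible [M] with [loss M <= epsy], and each feasible [M] lifts with equality. *)
Lemma P1_optimal_iff_P2_optimal M :
  P1_optimal s X Y Wx Wy S epsx M <->
  exists (ey : R) (u v : 'cV[R]_n), P2_optimal s X Y Wx S epsx (P2Var ey M u v).
Proof.
split=> [[feas max] | [ey [u [v [/P2_feasible_loss[feas le_ey] min]]]]].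
  exists (loss M), (dx M), (dy M); split; first exact: P2_feasible_at_loss.
  by case=> ey M' u v /P2_feasible_loss[/max]; rewrite le_Vol_attack; apply: le_trans.
split=> // M' /P2_feasible_at_loss /min le_loss.
by rewrite le_Vol_attack (le_trans le_ey).
Qed.

End PrivacyFilter.

Theorem theorem12 (R : realType) (n p q : nat) (s : lin_system R n p q)
    (hA1 : A1 s \in unitmx) (hA2 : A2 s \in unitmx)
    (x y : nat -> 'cV[R]_n) (wx : nat -> 'cV[R]_p) (wy : nat -> 'cV[R]_q)
    (Wx : nat -> endpoints R p) (Wy : nat -> endpoints R q)
    (htraj : trajectory s x y wx wy)
    (hWx : forall j, (0 < j)%N -> box (Wx j) (wx j))
    (hWy : forall j, (0 < j)%N -> box (Wy j) (wy j))
    (k : nat) (hk : (1 <= k)%N)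
    (X Y : endpoints R n)
    (hX : box X (x k.-1)) (hY : box Y (y k.-1))
    (epsx : R) (hepsx : 0 < epsx)
    (S : endpoints R n)
    (hSx : box S (x k))
    (hSsub : box S `<=` box (predicted s X Y (Wx k)))
    (hSvol : Vol S <= epsx)
    (M : endpoints R n) :
  P1_optimal s X Y (Wx k) (Wy k) S epsx M <->
  exists (ey : R) (dx dy : 'cV[R]_n),
    P2_optimal s X Y (Wx k) S epsx (P2Var ey M dx dy).
Proof.
(* The true state [x k] witnesses that [S] is nonempty, so its endpoints are ordered. *)
by apply: P1_optimal_iff_P2_optimal; apply: box_nonempty_interval hSx.
Qed.
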